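(* Let $T>0$, $\beta\in(0,1]$, and let $\eta:S\to(0,\infty)$ be measurable such that (i) there is a constant $c_T>0$ with $\frac1{c_T}\eta(y)\le E_{r,y}[\eta(Z_t)]\le c_T\eta(y)$ for $0\le r\le t\le T$ and $y\in S$, and (ii) $E_{t,y}[\eta(Z_T)]\to\eta(y)$ uniformly in $y$ as $t\uparrow T$. Let $X=(X_t,\mathcal G(I),\mathbb P_{r,\mu})$ be the superprocess on $[0,T]$ with parameters $Z$, $K(ds)=\frac1\beta\eta(Z_s)\,ds$ and $\psi(y,\xi)=(\xi/\eta(y))^{1+\beta}$. Let $h(r,y):=E_{r,y}[\eta(Z_T)]$ and $$c_{r,T}:=\sup_{t\in[r,T]}\sup_{y\in S}\frac{h(t,y)}{\eta(y)}.$$ Then, for $0\le r<T$ and $z\in S$, $$-\log\mathbb P_{r,\delta_z}[X_T=0]\ge\frac{h(r,z)}{c_{r,T}\,(T-r)^{1/\beta}}.$$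
   Context: Markov process: $Z=(Z_t,\mathcal F(I),P_{r,z})$ is a time-inhomogeneous right (Markov) process with sample space $(\Omega,\mathcal F)$ and state space $(S,\mathcal B)$, where $S$ is a metrizable Luzin space with Borel field $\mathcal B$. The $\sigma$-algebra $\mathcal F(I)\subset\mathcal F$ contains the events observable during the time interval $I\subset[0,\infty)$. $P_{r,\mu}$ is the measure under which $Z$ starts at time $r\ge0$ with initial distribution $\mu$; $P_{r,z}=P_{r,\delta_z}$. ''Right process'' means that $t\mapsto Z_t(\omega)$ is càdlàg and that for $r<t$, measurable $f:S\to\mathbb R_+$ and probability measures $\mu$, the process $s\mapsto E_{s,Z_s}[f(Z_t)]$ is $P_{r,\mu}$-a.s. right-continuous on $[r,t)$. Superprocess: $\langle f,\nu\rangle=\int f\,d\nu$. $\mathcal M^\eta$ is the class of nonnegative measures $\mu$ on $(S,\mathcal B)$ with $\int\eta\,d\mu<\infty$; $B_\eta^+$ is the class of bounded $\mathcal B$-measurable $f:S\to\mathbb R_+$ with $f\le c\eta$ for some constant $c$. The superprocess $X=((X_t)_{t\le T},\mathcal G(I),\mathbb P_{r,\mu})$ with the stated parameters is the $\mathcal M^\eta$-valued Markov process with $\mathbb E_{r,\mu}[e^{-\langle f,X_t\rangle}]=e^{-\langle u(r,\cdot),\mu\rangle}$ for $f\in B_\eta^+$, $\mu\in\mathcal M^\eta$, $r\le t\le T$, where $u$ is the unique solution in $B_\eta^+$ of $u(r,y)=E_{r,y}[f(Z_t)-\int_r^tu(s,Z_s)^{1+\beta}\frac1{\beta\eta(Z_s)^\beta}\,ds]$.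 $\{X_T=0\}$ is the event that $X_T$ is the zero measure. *)

(* Defs.v *)
From HB Require Import structures.
From mathcomp Require Import all_boot all_order all_algebra.
From mathcomp Require Import all_classical all_reals all_analysis.
From mathcomp Require Import measurable_realfun.

Set Implicit Arguments.
Unset Strict Implicit.
Unset Printing Implicit Defensive.

Import Order.TTheory GRing.Theory Num.Theory.
Import numFieldNormedType.Exports.

Local Open Scope classical_set_scope.
Local Open Scope ring_scope.

(* A topological space is carried by a [ptopologicalType]; its Borel field is
   the measurable structure of [borel S], whose carrier is [S] itself. *)
Notation borel S := (g_sigma_algebraType (@open S)).

(* Metrizable Luzin space: homeomorphic to a Borel subset of a compact
   metrizable space.  The third clause says that the topology of [S] is the
   one pulled back along the injection [f]. *)
Definition metrizable_luzin (R : realType) (S : ptopologicalType) : Prop :=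
  exists (K : pseudoMetricType R) (f : S -> K),
    [/\ compact [set: K] /\ hausdorff_space K,
        injective f,
        forall U : set S, open U <-> exists2 V : set K, open V & U = f @^-1` V
      & <<s (@open K) >> (range f)].

(* Time-inhomogeneous Markov process with time set [D], sample space [Om] and
   state space [E].  [obs I] is the field of the events observable during the
   time interval [I]; [law r mu] is the measure under which the process starts
   at time [r] with initial distribution [mu]. *)
Record markov_process (R : realType) (d1 d2 : measure_display)
    (Om : measurableType d1) (E : measurableType d2) (D : set R) := MarkovProcess {
  traj :> R -> Om -> E ;
  obs : interval R -> set (set Om) ;
  law : R -> probability E R -> probability Om R ;
  obs_sigma_algebra : forall I : interval R, [set` I] `<=` D ->
    sigma_algebra [set: Om] (obs I) ;
  obs_measurable : forall I : interval R, [set` I] `<=` D ->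
    obs I `<=` measurable ;
  obs_mono : forall I J : interval R, [set` I] `<=` [set` J] -> [set` J] `<=` D ->
    obs I `<=` obs J ;
  obs_traj : forall (I : interval R) (t : R) (B : set E), [set` I] `<=` D ->
    t \in I -> measurable B -> obs I (traj t @^-1` B) ;
  law_measurable : forall (r : R) (A : set Om), D r -> measurable A ->
    measurable_fun [set: E] (fun z => law r \d_z A) ;
  law_mixture : forall (r : R) (mu : probability E R) (A : set Om), D r ->
    measurable A -> law r mu A = (\int[mu]_z law r \d_z A)%E ;
  law_initial : forall (r : R) (mu : probability E R) (B : set E), D r ->
    measurable B -> law r mu (traj r @^-1` B) = mu B ;
  law_markov : forall (r t : R) (mu : probability E R) (J : interval R)
      (A B : set Om), D r -> D t -> r <= t ->
    [set` J] `<=` D `&` [set s | t <= s] ->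
    obs `[r, t] A -> obs J B ->
    law r mu (A `&` B) = (\int[law r mu]_(w in A) law t \d_(traj t w) B)%E
}.

(* P_{r,z} = P_{r,delta_z} *)
Definition law_at (R : realType) (d1 d2 : measure_display)
    (Om : measurableType d1) (E : measurableType d2) (D : set R)
    (Z : markov_process Om E D) (r : R) (z : E) : probability Om R :=
  law Z r \d_z.

Section right_process.
Context (R : realType) (S : ptopologicalType) (d : measure_display)
  (Om : measurableType d).

Definition cadlag (x : R -> S) : Prop :=
  (forall t : R, 0 <= t -> x s @[s --> t^'+] --> x t) /\
  (forall t : R, 0 < t -> exists l : S, x s @[s --> t^'-] --> l).

Definition right_process
    (Z : markov_process Om (borel S) [set t : R | 0 <= t]) : Prop :=
  (forall w : Om, cadlag (fun t => Z t w : S)) /\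
  (forall (r t : R) (f : borel S -> R) (mu : probability (borel S) R),
    0 <= r < t -> measurable_fun [set: borel S] f -> (forall y, 0 <= f y) ->
    {ae law Z r mu, forall w, forall s : R, r <= s < t ->
      'E_(law_at Z q (Z q w))[fun w' => f (Z t w')]%E @[q --> s^'+]
        --> 'E_(law_at Z s (Z s w))[fun w' => f (Z t w')]%E}).

End right_process.

Section measures_eta.
Context (R : realType) (d : measure_display) (S : measurableType d)
  (eta : {mfun S >-> R}).

Record measures_eta_carrier : Type := MeasureEta {
  measure_of : {measure set S -> \bar R} ;
  measure_of_fin : (\int[measure_of]_y (eta y)%:E < +oo)%E
}.

HB.instance Definition _ := gen_eqMixin measures_eta_carrier.
HB.instance Definition _ := gen_choiceMixin measures_eta_carrier.

Fact mzero_eta : (\int[@mzero d S R]_y (eta y)%:E < +oo)%E.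
Proof. by rewrite integral_measure_zero. Qed.

HB.instance Definition _ :=
  isPointed.Build measures_eta_carrier (MeasureEta mzero_eta).

(* The class M^eta, with the field generated by the evaluations mu |-> mu(B). *)
Definition eval_preimages : set (set measures_eta_carrier) :=
  \bigcup_(B in @measurable d S) preimage_set_system
    [set: measures_eta_carrier] (fun mu => measure_of mu B) measurable.

Fact dirac_eta (z : S) : (\int[\d_z]_y (eta y)%:E < +oo)%E.
Proof.
rewrite integral_dirac//; last exact/measurable_EFinP.
by rewrite diracT mul1e ltry.
Qed.

Definition delta_eta (z : S) : measures_eta_carrier := MeasureEta (dirac_eta z).

(* The class B_eta^+. *)
Definition bounded_eta (f : S -> R) : Prop :=
  [/\ measurable_fun [set: S] f, forall y, 0 <= f y,
      exists c : R, forall y, f y <= c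
    & exists c : R, forall y, f y <= c * eta y].

(* <f, mu> *)
Definition pairing (f : S -> R) (mu : measures_eta_carrier) : \bar R :=
  (\int[measure_of mu]_y (f y)%:E)%E.

End measures_eta.

Notation measures_eta eta := (g_sigma_algebraType (@eval_preimages _ _ _ eta)).

Section superprocess.
Context (R : realType) (S : ptopologicalType) (d : measure_display)
  (Om : measurableType d)
  (Z : markov_process Om (borel S) [set t : R | 0 <= t])
  (beta : R) (eta : {mfun borel S >-> R}).

(* [u], restricted to times in [0, t], solves
     u(r, y) = E_{r,y}[f(Z_t) - \int_r^t u(s, Z_s)^(1+beta) / (beta eta(Z_s)^beta) ds],
   in which the integrand is psi(Z_s, u(s, Z_s)) K(ds)/ds for
   psi(y, xi) = (xi / eta(y))^(1+beta) and K(ds) = eta(Z_s) ds / beta.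
   The second clause makes the path integral meaningful: for every starting
   time and initial law, s |-> u(s, Z_s) is indistinguishable from a jointly
   measurable process.  Joint measurability of [u] itself would exclude some
   right processes, whose transition functions need not be jointly
   measurable in the starting time and point. *)
Definition log_laplace (t : R) (f : borel S -> R) (u : R -> borel S -> R) : Prop :=
  [/\ forall s, 0 <= s <= t -> bounded_eta eta (u s),
      forall (r : R) (mu : probability (borel S) R), 0 <= r <= t ->
        exists2 V : R * Om -> R, measurable_fun [set: R * Om] V &
          {ae law Z r mu, forall w, forall s : R, r <= s <= t ->
            u s (Z s w) = V (s, w)}
    & forall (r : R) (y : borel S), 0 <= r <= t ->
        (u r y)%:E = (\int[law_at Z r y]_w
          ((f (Z t w))%:E -
           \int[lebesgue_measure]_(s in `[r, t])
              (u s (Z s w) `^ (1 + beta) / (beta * eta (Z s w) `^ beta))%:E))%E].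

(* The superprocess on [0, T]: the M^eta-valued Markov process with
     EE_{r,mu}[exp(-<f, X_t>)] = exp(-<u(r, .), mu>),
   where [u] is the unique solution of the above equation. *)
Definition superprocess (T : R) (d' : measure_display) (OmX : measurableType d')
    (X : markov_process OmX (measures_eta eta) `[0, T]) : Prop :=
  forall (t : R) (f : borel S -> R), 0 <= t <= T -> bounded_eta eta f ->
    exists u : R -> borel S -> R,
      [/\ log_laplace t f u,
          forall v : R -> borel S -> R, log_laplace t f v ->
            forall (s : R) (y : borel S), 0 <= s <= t -> v s y = u s y
        & forall (r : R) (mu : measures_eta eta), 0 <= r <= t ->
            (\int[law_at X r mu]_w expeR (- pairing f (X t w)) =
             expeR (- pairing (u r) mu))%E].

(* h(r, y) = E_{r,y}[eta(Z_T)] *)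
Definition harm (T r : R) (y : borel S) : \bar R :=
  'E_(law_at Z r y)[fun w => eta (Z T w)]%E.

(* c_{r,T} *)
Definition sup_ratio (r T : R) : \bar R :=
  ereal_sup [set x | exists (t : R) (y : borel S),
    r <= t <= T /\ x = (harm T t y / (eta y)%:E)%E].

End superprocess.

(* {X_t = 0} *)
Definition extinct (R : realType) (d d' : measure_display) (S : measurableType d)
    (eta : {mfun S >-> R}) (Om : measurableType d') (D : set R)
    (X : markov_process Om (measures_eta eta) D) (t : R) : set Om :=
  [set w | forall B : set S, measurable B -> measure_of (X t w) B = 0%E].

(* Main.v *)
Require Import Defs.
From HB Require Import structures.
From mathcomp Require Import all_boot all_order all_algebra.
From mathcomp Require Import all_classical all_reals all_analysis.
From mathcomp Require Import measurable_realfun giry.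
From mathcomp Require Import lra ring.

Set Implicit Arguments.
Unset Strict Implicit.
Unset Printing Implicit Defensive.

Import Order.TTheory GRing.Theory Num.Theory.
Import numFieldNormedType.Exports.

Local Open Scope classical_set_scope.
Local Open Scope ring_scope.

(** The survival estimate comes from a comparison principle for the log-Laplace
    equation.

    For [0 <= f] the event [X_T = 0] is contained in [exp (- <f, X_T>) = 1], so
    [P_{r, delta_z}[X_T = 0] <= exp (- u (r, z))], where [u] is the log-Laplace
    function of [f].  It is therefore enough to bound [u] from below for a
    family of test functions [f].  The function [eta] may be unbounded, hence
    not admissible; the test functions are multiples of [phi = min (eta, n)].
    Put [H (t, y) = E_{t,y}[phi (Z_T)] <= c * eta y], where [c = c_{r,T}], and
      [g t = (eps + c^beta (T - t))^(-1/beta)],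
    which solves [g' = c^beta / beta * g^(1 + beta)].  Since [H (t, Z_t)] is a
    martingale and [(H / eta)^beta <= c^beta], the product [g H] is a subsolution
    of the log-Laplace equation with terminal value [g T * phi].  Comparison
    gives [g r * H (r, z) <= u (r, z)] for [f = g T * phi]
    (lemma [log_laplace_ge_profile]).  Letting [eps] tend to [0] and [n] to
    infinity turns [g r * H (r, z)] into [h (r, z) / (c (T - r)^(1/beta))].

    The comparison itself uses the Markov property only through one-dimensional
    marginals.  Fix a starting point [(r, y)] and let [a s] be the mean of
    [D (s, Z_s)], where [D = g H - u].  Taking means in the log-Laplace equation
    (lemma [log_laplace_averaged]) shows that [a s] is the integral over [s, T]
    of a scalar function, and the Lipschitz bound for [xi^(1 + beta)] on the
    range [xi <= C * eta] (lemma [rate_lipschitz]) bounds that function by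
    [K (M - a)], where [M >= 0] is the supremum of the positive part of [D].  A
    Gronwall argument for [M - a] (lemma [gronwall_halving]) yields
    [M <= 2^N (M - D (r, y))] with [N] independent of [(r, y)]; taking the
    supremum over [(r, y)] forces [M = 0], that is [g H <= u].

    Two measurability points need care.  The path integral in the log-Laplace
    equation is measurable only up to a null set that depends on the initial
    law, so the integrals are compared up to null sets, and the mean of the
    equation at time [s] is taken under the process restarted at [s] with the
    law of [Z_s] as initial distribution (lemma [restart_int]).  The weight
    [eta (Z_s)] is jointly measurable in [s] and the sample point because the
    paths are right-continuous in a metrizable space
    (lemma [measurable_traj_joint]). *)

(** * Integrals up to null sets *)

Section ae_comparison.
Context (R : realType) (d : measure_display) (T : measurableType d)
  (mu : {measure set T -> \bar R}).

Lemma bounded_integrable (P : probability T R) (g : T -> R) (B : R) :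
    measurable_fun [set: T] g -> (forall x, `|g x| <= B) ->
  P.-integrable [set: T] (EFin \o g).
Proof.
move=> mg gB; apply: measurable_bounded_integrable => //.
  by apply: le_lt_trans (probability_le1 P _) _; rewrite ?ltry.
exists B; split; first exact: num_real.
by move=> M BM x _; apply: le_trans (gB x) _; exact: ltW.
Qed.

Import HBNNSimple.

Local Open Scope ereal_scope.

(** The integral of a nonnegative function is a supremum over the simple functions
    below it, and such a simple function can be set to zero on the exceptional
    set.  The lemma is stated for arbitrary functions because the path integral of
    the log-Laplace equation is only almost everywhere equal to a measurable
    one. *)
Lemma ge0_ae_le_integral_any (f g : T -> \bar R) :
    (forall x, 0 <= f x) -> (forall x, 0 <= g x) ->
  {ae mu, forall x, f x <= g x} -> \int[mu]_x f x <= \int[mu]_x g x.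
Proof.
move=> f0 g0 [N [mN N0 fgN]].
rewrite [leLHS]ge0_integralTE// [leRHS]ge0_integralTE//.
apply: ge_ereal_sup => _ [/= h hf <-].
have mCN : measurable (~` N) by exact: measurableC.
pose hN := mul_nnsfun h (indic_nnsfun R mCN).
have -> : sintegral mu h = sintegral mu hN.
  rewrite -!integralT_nnsfun; apply: ge0_ae_eq_integral => //.
  - by apply/measurable_EFinP.
  - by apply/measurable_EFinP.
  - by move=> x _; rewrite lee_fin.
  - by move=> x _; rewrite lee_fin.
  exists N; split => // x /=; apply: contra_notP => Nx _.
  by rewrite /hN /= /mindic indicE mem_set// mulr1.
apply: ereal_sup_ubound; exists hN => //= x.
rewrite /mindic indicE; have [xN|xN] := boolP (x \in ~` N); last first.
  by rewrite mulr0.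
rewrite mulr1; apply: le_trans (hf x) _.
by move: xN; rewrite inE /=; apply: contra_notP => /fgN.
Qed.

Lemma ae_eq_integral_any (f g : T -> \bar R) :
  {ae mu, forall x, f x = g x} -> \int[mu]_x f x = \int[mu]_x g x.
Proof.
move=> fg; rewrite integralE [RHS]integralE.
congr (_ - _); apply/eqP; rewrite eq_le; apply/andP; split;
  apply: ge0_ae_le_integral_any => //;
  by apply: filterS fg => x fgx; rewrite ?funeposE ?funenegE fgx.
Qed.

Lemma integralB_le (f g : T -> \bar R) :
    (forall x, 0 <= f x) -> (forall x, 0 <= g x) ->
  \int[mu]_x (f x - g x) <= \int[mu]_x f x.
Proof.
move=> f0 g0; rewrite integralE.
apply: (@le_trans _ _ (\int[mu]_x (fun x => f x - g x)^\+ x)).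
  by apply: geeDl; rewrite oppe_le0; apply: integral_ge0.
apply: ge0_ae_le_integral_any => //; apply: aeW => x.
by rewrite funeposE ge_max f0 andbT; apply: geeDl; rewrite oppe_le0.
Qed.

End ae_comparison.

Section fubini_indistinguishable.
Context (R : realType) (d : measure_display) (Om : measurableType d)
  (P : probability Om R).
Local Notation mu := (@lebesgue_measure R).

(** Tonelli for a process that agrees, outside one null set and for all times of
    the interval at once, with a jointly measurable function.  The path integrals
    agree almost surely with the measurable variable [J], and the mean of [J] can
    be computed by integrating the one-dimensional means over time. *)
Lemma fubini_indistinguishable (a b : R) (F : R -> Om -> R) (V : R * Om -> R) :
    measurable_fun [set: R * Om] V ->
    (forall q w, a <= q <= b -> 0 <= F q w) ->
    (forall q, a <= q <= b -> measurable_fun [set: Om] (F q)) ->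
    {ae P, forall w, forall q, a <= q <= b -> F q w = V (q, w)} ->
  measurable_fun `[a, b] (fun q => \int[P]_w (F q w)%:E)%E /\
  exists J : Om -> \bar R,
    [/\ measurable_fun [set: Om] J, forall w, (0 <= J w)%E,
        {ae P, forall w, (\int[mu]_(q in `[a, b]) (F q w)%:E)%E = J w}
      & (\int[P]_w J w = \int[mu]_(q in `[a, b]) \int[P]_w (F q w)%:E)%E].
Proof.
move=> mV F0 mF FV.
pose W := (fun x => (`|V x|)%:E) \_ (`[a, b] `*` [set: Om]).
have W0 x : (0 <= W x)%E by rewrite /W patchE; case: ifP => // _; rewrite lee_fin.
have mW : measurable_fun [set: R * Om] W.
  apply/(measurable_restrictT _ _).1; first exact: measurableX.
  by apply/measurable_EFinP/measurableT_comp => //; exact: measurable_funTS.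
have WE q w : W (q, w) = if q \in `[a, b]%classic then `|V (q, w)|%:E else 0%E.
  rewrite /W patchE; congr (if _ then _ else _).
  by apply/idP/idP; rewrite !inE /=; [case|].
have FE q : a <= q <= b -> (\int[P]_w (F q w)%:E = \int[P]_w W (q, w))%E.
  move=> qab; apply: ge0_ae_eq_integral => //.
  - by apply/measurable_EFinP; exact: mF.
  - by apply: measurableT_comp mW _; exact: pair1_measurable.
  - by move=> w _; rewrite lee_fin F0.
  - apply: filterS FV => w FVw _; rewrite WE ifT; last by rewrite inE /= in_itv.
    by rewrite -FVw// ger0_norm// F0.
have mab : measurable `[a, b]%classic by [].
split.
  have := measurable_fun_fubini_tonelli_F (m2 := P) W mW W0.
  move=> /(measurable_funS measurableT (subsetT `[a, b]%classic)).
  by apply: eq_measurable_fun => q; rewrite inE /= in_itv /= => /FE ->.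
exists (fun w => \int[mu]_q W (q, w))%E; split.
- exact: (measurable_fun_fubini_tonelli_G (m1 := mu) W mW W0).
- by move=> w; apply: integral_ge0.
- apply: filterS FV => w FVw; rewrite integral_mkcond.
  apply: eq_integral => q _; rewrite WE patchE; case: ifP => //.
  by rewrite inE /= in_itv /= => qab; rewrite -FVw// ger0_norm// F0.
- have /= <- := fubini_tonelli (m1 := mu) (m2 := P) W mW W0.
  rewrite [RHS]integral_mkcond; apply: eq_integral => q _; rewrite patchE.
  case: ifPn => [|qab]; first by rewrite inE /= in_itv /= => /FE ->.
  rewrite /fubini_F; apply: integral0_eq => w _; rewrite WE ifN//.
Qed.

End fubini_indistinguishable.

(** * The Markov property in integrated form *)

Section markov_property.
Context (R : realType) (d1 d2 : measure_display) (Om : measurableType d1)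
  (E : measurableType d2) (Z : markov_process Om E [set t : R | 0 <= t]).

Lemma obs_traj1 (s t q : R) (B : set E) : 0 <= s -> s <= q <= t ->
  measurable B -> obs Z `[s, t] (Z q @^-1` B).
Proof.
move=> s0 sqt mB; apply: obs_traj => //.
by move=> x; rewrite /= in_itv/= => /andP[sx _]; exact: le_trans sx.
Qed.

Lemma measurable_traj (t : R) : 0 <= t -> measurable_fun [set: Om] (Z t).
Proof.
move=> t0 _ B mB; rewrite setTI; apply: (@obs_measurable _ _ _ _ _ _ Z `[t, t]).
  by move=> x; rewrite /= in_itv/= => /andP[tx _]; exact: le_trans tx.
by apply: obs_traj1 => //; rewrite lexx.
Qed.

Let kern (t : R) (y : E) : giry Om R := law_at Z t y.

Let measurable_kern (t : R) : 0 <= t -> measurable_fun [set: E] (kern t).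
Proof.
by move=> t0; apply: measurable_giry_codensity => // B mB; exact: law_measurable.
Qed.

Lemma measurable_law_int (t : R) (h : Om -> \bar R) : 0 <= t ->
    measurable_fun [set: Om] h -> (forall w, 0 <= h w)%E ->
  measurable_fun [set: E] (fun y => \int[law_at Z t y]_w h w)%E.
Proof.
move=> t0 mh h0.
exact: (measurableT_comp (measurable_giry_int mh h0) (measurable_kern t0)).
Qed.

(** The mixture identity for events makes [law Z t mu] the composition of [mu]
    with the transition kernel, so it extends from events to nonnegative
    functions. *)
Lemma law_mixture_int (t : R) (mu : probability E R) (h : Om -> \bar R) :
    0 <= t -> measurable_fun [set: Om] h -> (forall w, 0 <= h w)%E ->
  (\int[law Z t mu]_w h w = \int[mu]_y \int[law_at Z t y]_w h w)%E.
Proof.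
move=> t0 mh h0.
have := @giry_int_bind _ _ _ _ _ mu _ (measurable_kern t0) h mh h0.
rewrite /giry_int => <-; apply: eq_measure_integral => A mA _.
rewrite /giry_bind /giry_join /= [LHS](law_mixture Z mu)//.
by rewrite giry_int_map//; exact: measurable_giry_ev.
Qed.

(** The mass of a null set of the mixture is the mean over [mu] of its masses under
    the components, and a nonnegative function of zero mean vanishes almost
    everywhere. *)
Lemma law_mixture_ae (t : R) (mu : probability E R) (A : Om -> Prop) : 0 <= t ->
    {ae law Z t mu, forall w, A w} ->
  {ae mu, forall y, {ae law_at Z t y, forall w, A w}}.
Proof.
move=> t0 [N [mN N0 AN]].
have mlaw : measurable_fun [set: E] (fun y => law_at Z t y N).
  exact: law_measurable.
have : ae_eq mu setT (fun y => law_at Z t y N) (cst 0%E).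
  apply/(ae_eq_integral_abs mu measurableT mlaw).
  under eq_integral do rewrite gee0_abs//.
  by rewrite -N0 [RHS](law_mixture Z).
by apply: filterS => y /(_ I) yN; exists N.
Qed.

Definition traj_mfun (t : R) (t0 : 0 <= t) : Om -> E := Z t.

HB.instance Definition _ (t : R) (t0 : 0 <= t) :=
  @isMeasurableFun.Build _ _ _ _ (traj_mfun t0) (measurable_traj t0).

Definition traj_law (r : R) (mu : probability E R) (t : R) (t0 : 0 <= t) :
  probability E R := distribution (law Z r mu) (traj_mfun t0).

Lemma traj_law_int (r : R) (mu : probability E R) (t : R) (t0 : 0 <= t)
    (h : E -> \bar R) : measurable_fun [set: E] h -> (forall y, 0 <= h y)%E ->
  (\int[traj_law r mu t0]_y h y = \int[law Z r mu]_w h (Z t w))%E.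
Proof. by move=> mh h0; rewrite ge0_integral_distribution. Qed.

(** By the mixture identity and the Markov property both sides are the mean, over
    the position at time [s], of the transition from [s] to [q].  The point of the
    left side is that properties assumed for every starting time and initial law
    apply to the process started at time [s]. *)
Lemma restart_int (r s q : R) (mu : probability E R) (s0 : 0 <= s)
    (h : E -> \bar R) : 0 <= r -> r <= s -> s <= q ->
    measurable_fun [set: E] h -> (forall y, 0 <= h y)%E ->
  (\int[law Z s (traj_law r mu s0)]_w h (Z q w) =
   \int[law Z r mu]_w h (Z q w))%E.
Proof.
move=> r0 rs sq mh h0; have q0 : 0 <= q by exact: le_trans sq.
rewrite -(traj_law_int _ _ q0)// -[RHS](traj_law_int _ _ q0)//.
apply: eq_measure_integral => B mB _.
rewrite /traj_law /distribution /pushforward /=.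
have mq : measurable (Z q @^-1` B).
  by rewrite -[X in measurable X]setTI; exact: measurable_traj.
rewrite [LHS](law_mixture Z)// traj_law_int//; last exact: law_measurable.
have /= := @law_markov _ _ _ _ _ _ Z r s mu `[q, q] setT (Z q @^-1` B) r0 s0 rs.
rewrite setTI => restart; apply/esym/restart => //.
- move=> x; rewrite /= in_itv/= => /andP[qx _].
  by split; [exact: le_trans qx|exact: le_trans qx].
- by rewrite -(preimage_setT (Z r)); apply: obs_traj1; rewrite ?lexx.
- by apply: obs_traj1; rewrite ?lexx.
Qed.

Lemma law_initial_int (r : R) (y : E) (h : E -> \bar R) : 0 <= r ->
    measurable_fun [set: E] h -> (forall y, 0 <= h y)%E ->
  (\int[law_at Z r y]_w h (Z r w) = h y)%E.
Proof.
move=> r0 mh h0; rewrite -(traj_law_int _ _ r0)//.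
have <- : (\int[\d_y]_x h x = h y)%E by rewrite integral_dirac// diracT mul1e.
by apply: eq_measure_integral => B mB _; exact: law_initial.
Qed.

Lemma law_tower (r s q : R) (y : E) (h : E -> \bar R) : 0 <= r -> r <= s ->
    s <= q -> measurable_fun [set: E] h -> (forall y, 0 <= h y)%E ->
  (\int[law_at Z r y]_w \int[law_at Z s (Z s w)]_w' h (Z q w') =
   \int[law_at Z r y]_w h (Z q w))%E.
Proof.
move=> r0 rs sq mh h0; have s0 := le_trans r0 rs; have q0 := le_trans s0 sq.
have mhZ : measurable_fun [set: Om] (fun w => h (Z q w)).
  exact: measurableT_comp mh (measurable_traj q0).
rewrite -[RHS](restart_int _ s0)// law_mixture_int// traj_law_int//.
  exact: measurable_law_int.
by move=> x; exact: integral_ge0.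
Qed.

End markov_property.

(** * Joint measurability of right-continuous paths *)

Section joint_measurability.
Context (R : realType) (S : ptopologicalType) (hS : metrizable_luzin R S).

(** Embed [S] in a metric space [K] by [f].  An open set [U = f^-1 V] is the union
    of the open sets [W m] of points whose image has a neighbourhood of centres of
    balls of radius [1 / (m + 1)] inside [V], and the limit belongs to [U] if and
    only if the sequence is eventually in one of the [W m]. *)
Lemma measurable_lim_borel (d : measure_display) (T : measurableType d)
    (F : nat -> T -> borel S) (G : T -> borel S) :
    (forall n, measurable_fun [set: T] (F n)) ->
    (forall x, (F n x : S) @[n --> \oo] --> (G x : S)) ->
  measurable_fun [set: T] G.
Proof.
move=> mF FG; have [K [f [_ _ openf _]]] := hS.
apply: (@measurability _ _ T (borel S) setT G (@open S)) => //= _ [U oU <-].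
rewrite setTI.
have /openf[V oV UV] := oU.
have f_nbhs (x : S) (A : set K) : nbhs (f x) A -> nbhs x (f @^-1` A).
  rewrite nbhsE => -[B [oB Bx] BA].
  apply: (@filterS _ _ _ (f @^-1` B)); first by move=> y; exact: BA.
  by apply: open_nbhs_nbhs; split=> //; apply/openf; exists B.
pose W m := f @^-1` [set x | ball x m.+1%:R^-1 `<=` V]°.
have oW m : open (W m).
  by apply/openf; exists [set x | ball x m.+1%:R^-1 `<=` V]°; first exact: open_interior.
have -> : G @^-1` U = \bigcup_m \bigcup_N \bigcap_n (F (N + n)%N @^-1` W m).
  apply/seteqP; split => [x /= Ux|x /= [m _ [N _ FW]]].
    have [e e0 eV] : exists2 e : R, 0 < e & ball (f (G x)) e `<=` V.
      apply/nbhs_ballP; apply: open_nbhs_nbhs; split=> //.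
      by move: Ux; rewrite UV.
    have [m me] : exists m, m.+1%:R^-1 <= e / 2.
      exists (Num.truncn (e / 2)^-1); rewrite invf_ple ?posrE ?divr_gt0//.
      exact/ltW/truncnS_gt.
    have GW : W m (G x).
      rewrite /W /= /interior /=; apply/nbhs_ballP; exists (e / 2) => /=.
        by rewrite divr_gt0.
      move=> y xy z yz; apply: eV; rewrite [e]splitr.
      apply: ball_triangle xy _; exact: le_ball yz.
    have /FG : nbhs (G x : S) (W m) by exact: open_nbhs_nbhs.
    case=> N _ NW; exists m => //; exists N => // n _ /=.
    by apply: NW => /=; exact: leq_addr.
  rewrite UV /=.
  have : nbhs (G x : S) (f @^-1` ball (f (G x)) m.+1%:R^-1).
    by apply: f_nbhs; exact: nbhsx_ballx.
  move=> /FG[N' _ N'W].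
  have {}N'W := N'W (N + N')%N (leq_addl _ _).
  have := FW N' I; rewrite /W /= => /interior_subset; apply.
  exact: ball_sym.
apply: bigcupT_measurable => m; apply: bigcupT_measurable => N.
apply: bigcapT_measurable => n; rewrite -[X in measurable X]setTI.
apply: mF => //; apply: sub_sigma_algebra; exact: oW.
Qed.

Context (d : measure_display) (Om : measurableType d)
  (Z : markov_process Om (borel S) [set t : R | 0 <= t]).

(** The path is the limit of its values at the grid times [q n x], the first
    multiple of [1 / (n + 1)] strictly after [x]; these approach [x] from the
    right, where the path is continuous.  Negative times are sent to [0]. *)
Lemma measurable_traj_joint :
    (forall w : Om, forall t : R, 0 <= t -> (Z s w : S) @[s --> t^'+] --> (Z t w : S)) ->
  measurable_fun [set: R * Om] (fun x => Z (Num.max 0 x.1) x.2 : borel S).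
Proof.
move=> rcZ.
pose q n (x : R) : R := (Num.truncn (Num.max 0 x * n.+1%:R)).+1%:R / n.+1%:R.
have max0 (x : R) : 0 <= Num.max 0 x by rewrite le_max lexx.
have q_gt n x : Num.max 0 x < q n x.
  by rewrite /q ltr_pdivlMr// truncnS_gt.
have q_le n x : q n x <= Num.max 0 x + n.+1%:R^-1.
  rewrite /q ler_pdivrMr// mulrDl mulVf// -natr1 lerD2r.
  by rewrite truncn_le// mulr_ge0.
apply: (@measurable_lim_borel _ _ (fun n x => Z (q n x.1) x.2)).
  move=> n _ B mB; rewrite setTI.
  have -> : (fun x : R * Om => Z (q n x.1) x.2 : borel S) @^-1` B =
      \bigcup_k ([set x | Num.truncn (Num.max 0 x * n.+1%:R) = k] `*`
                 (Z (k.+1%:R / n.+1%:R) @^-1` B)).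
    apply/seteqP; split => [x /= Bx|x /= [k _ [/= <-]]//].
    by exists (Num.truncn (Num.max 0 x.1 * n.+1%:R)).
  apply: bigcupT_measurable => k; apply: measurableX.
    have -> : [set x : R | Num.truncn (Num.max 0 x * n.+1%:R) = k] =
        (fun x : R => Num.max 0 x * n.+1%:R) @^-1` `[k%:R, k.+1%:R[.
      apply/seteqP; split => x /=; rewrite in_itv/=.
        by move=> <-; rewrite truncn_itv// mulr_ge0.
      by move=> /truncn_def ->.
    rewrite -[X in measurable X]setTI.
    have mm : measurable_fun setT (fun x : R => Num.max 0 x * n.+1%:R).
      by apply: measurable_funM => //; apply: measurable_maxr.
    exact: mm.
  by rewrite -[X in measurable X]setTI; apply: measurable_traj.
move=> [x w] /=.
have := rcZ w _ (max0 x).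
have q_cvg : q n x @[n --> \oo] --> (Num.max 0 x)^'+.
  move=> A [e /= e0 eA].
  have [m me] : exists m, m.+1%:R^-1 < e.
    exists (Num.truncn e^-1); rewrite invf_plt ?posrE//.
    exact/truncnS_gt.
  exists m => // n /= mn; apply: eA => //=.
  rewrite ltr0_norm ?subr_lt0// opprB ltrBlDl.
  apply: le_lt_trans (q_le n x) _; rewrite ltrD2l.
  by apply: le_lt_trans me; rewrite lef_pV2 ?posrE// ler_nat.
exact: (cvg_comp _ _ q_cvg).
Qed.

End joint_measurability.

(** * The log-Laplace equation *)

Section log_laplace_theory.
Context (R : realType) (S : ptopologicalType) (hS : metrizable_luzin R S)
  (d : measure_display) (Om : measurableType d)
  (Z : markov_process Om (borel S) [set t : R | 0 <= t])
  (rcZ : forall w t, 0 <= t -> (Z s w : S) @[s --> t^'+] --> (Z t w : S))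
  (beta : R) (beta_gt0 : 0 < beta)
  (eta : {mfun borel S >-> R})
  (T : R) (f : borel S -> R) (u : R -> borel S -> R)
  (hf : bounded_eta eta f) (hu : log_laplace Z beta eta T f u).
Local Notation mu := (@lebesgue_measure R).

(** The integrand of the log-Laplace equation: [psi (x, v (q, x))] times the density
    of [K] for the stated parameters. *)
Definition branching_rate (v : R -> borel S -> R) (q : R) (x : borel S) : R :=
  v q x `^ (1 + beta) / (beta * eta x `^ beta).
Local Notation psi := (branching_rate u).

Lemma branching_rate_ge0 v q x : 0 <= branching_rate v q x.
Proof.
by rewrite /branching_rate divr_ge0 ?powR_ge0// mulr_ge0 ?powR_ge0// ltW.
Qed.

Lemma measurable_rate (dT : measure_display) (A : measurableType dT)
    (g h : A -> R) : measurable_fun [set: A] g -> measurable_fun [set: A] h ->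
  measurable_fun [set: A] (fun x => g x `^ (1 + beta) / (beta * h x `^ beta)).
Proof.
move=> mg mh.
have -> : (fun x => g x `^ (1 + beta) / (beta * h x `^ beta)) =
    (fun x => g x `^ (1 + beta) * (beta^-1 * h x `^ (- beta))).
  by apply/funext => x; rewrite invfM powRN.
apply: measurable_funM.
  exact: (measurableT_comp (measurable_powR _) mg).
apply: measurable_funM => //.
exact: (measurableT_comp (measurable_powR _) mh).
Qed.

Lemma measurable_branching_rate v q : measurable_fun [set: borel S] (v q) ->
  measurable_fun [set: borel S] (branching_rate v q).
Proof.
by move=> mv; exact: measurable_rate.
Qed.

Lemma log_laplace_le (s : R) (y : borel S) : 0 <= s <= T ->
  ((u s y)%:E <= \int[law_at Z s y]_w (f (Z T w))%:E)%E.
Proof.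
have [_ _ ueq] := hu; have [_ f0 _ _] := hf => hs.
rewrite ueq//; apply: integralB_le => [w|w]; first by rewrite lee_fin.
by apply: integral_ge0 => q _; rewrite lee_fin branching_rate_ge0.
Qed.

(** The mean of the log-Laplace equation at time [s] for the process started at
    [(r, y)], in additive form so that all terms are nonnegative.  The equation
    holds at each point of time [s]; it is integrated against the law [nu] of
    [Z_s].  For [nu]-almost every starting point the path integral [I] equals a
    measurable variable [J] that is chosen once for the mixture, which is what
    makes the exchange of the two integrals possible. *)
Lemma log_laplace_averaged (B r s : R) (y : borel S) :
    (forall q x, s <= q <= T -> psi q x <= B) ->
    0 <= r -> r <= s -> s <= T ->
  measurable_fun `[s, T] (fun q => \int[law_at Z r y]_w (psi q (Z q w))%:E)%E /\
  (\int[law_at Z r y]_w (u s (Z s w))%:E +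
     \int[mu]_(q in `[s, T]) \int[law_at Z r y]_w (psi q (Z q w))%:E =
   \int[law_at Z r y]_w (f (Z T w))%:E)%E.
Proof.
move=> psiB r0 rs sT; have [bu idu ueq] := hu; have [mf f0 [Mf fMf] _] := hf.
have s0 : 0 <= s by exact: le_trans rs.
have T0 : 0 <= T by exact: le_trans sT.
have psi0 q x : 0 <= psi q x by exact: branching_rate_ge0.
have mpsi q : 0 <= q <= T -> measurable_fun [set: borel S] (psi q).
  by move=> /bu[mu _ _ _]; exact: measurable_branching_rate.
have mpsiZ q : 0 <= q <= T -> measurable_fun [set: Om] (fun w => psi q (Z q w)).
  move=> qT; apply: measurableT_comp (mpsi _ qT) _; apply: measurable_traj.
  by case/andP: qT.
have sub q : s <= q <= T -> 0 <= q <= T.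
  by move=> /andP[sq ->]; rewrite (le_trans s0 sq).
pose nu := traj_law Z r \d_y s0.
have [V mV uV] : exists2 V : R * Om -> R, measurable_fun [set: R * Om] V &
    {ae law Z s nu, forall w, forall q, s <= q <= T -> u q (Z q w) = V (q, w)}.
  by apply: idu; rewrite s0 sT.
pose W (x : R * Om) :=
  V x `^ (1 + beta) / (beta * eta (Z (Num.max 0 x.1) x.2) `^ beta).
have mW : measurable_fun [set: R * Om] W.
  apply: measurable_rate => //; apply: measurableT_comp => //.
  exact: measurable_traj_joint.
have FW : {ae law Z s nu, forall w, forall q, s <= q <= T ->
    psi q (Z q w) = W (q, w)}.
  apply: filterS uV => w uV q sq; rewrite /W /branching_rate /= uV//.
  by case/andP: (sub _ sq) => q0 _; rewrite max_r.
have [mp [J [mJ J0 FJ intJ]]] :=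
  fubini_indistinguishable mW (fun q w _ => psi0 q (Z q w))
    (fun q sq => mpsiZ q (sub q sq)) FW.
have pE q : s <= q <= T -> (\int[law Z s nu]_w (psi q (Z q w))%:E =
    \int[law_at Z r y]_w (psi q (Z q w))%:E)%E.
  move=> sqT; have /andP[sq _] := sqT.
  apply: (restart_int _ _ _ (h := EFin \o psi q)) => //.
  - by apply/measurable_EFinP; exact: mpsi (sub _ sqT).
  - by move=> x; rewrite lee_fin.
split.
  by apply: eq_measurable_fun mp => q; rewrite inE /= in_itv /= => /pE.
pose I w := (\int[mu]_(q in `[s, T]) (psi q (Z q w))%:E)%E.
have I_ge0 w : (0 <= I w)%E by apply: integral_ge0 => q _; rewrite lee_fin.
have IB w : (I w <= (B * (T - s))%:E)%E.
  have -> : ((B * (T - s))%:E = \int[mu]_(q in `[s, T]) B%:E)%E.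
    rewrite integral_cst//= lebesgue_measure_itv/= lte_fin.
    case: ltP => [//|Ts]; have -> : T = s by apply/eqP; rewrite eq_le sT Ts.
    by rewrite subrr mulr0 mule0.
  have B0 : 0 <= B by apply: le_trans (psi0 T y) (psiB T y _); rewrite sT lexx.
  rewrite /I integral_mkcond [leRHS]integral_mkcond.
  apply: ge0_ae_le_integral_any => [q|q|].
  - by rewrite patchE; case: ifP => // _; rewrite lee_fin.
  - by rewrite patchE; case: ifP => // _; rewrite lee_fin.
  apply: aeW => q; rewrite !patchE; case: ifP => //.
  by rewrite inE /= in_itv /= => sq; rewrite lee_fin psiB.
(* The truncation makes [J] bounded everywhere, and [I <= B * (T - s)] shows
   that it does not change [J] where [I = J]. *)
pose J' w := mine (J w) (B * (T - s))%:E.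
have IJ' w : I w = J w -> I w = J' w.
  by move=> IJ; rewrite /J' -IJ min_l.
have J'0 w : (0 <= J' w)%E.
  by rewrite /J' le_min J0 (le_trans (I_ge0 w)).
have mJ' : measurable_fun [set: Om] J' by exact: measurable_mine.
have mfZ : measurable_fun [set: Om] (fun w => f (Z T w)).
  by apply: measurableT_comp mf _; exact: measurable_traj.
have usE : {ae nu, forall z, ((u s z)%:E + \int[law_at Z s z]_w J' w =
    \int[law_at Z s z]_w (f (Z T w))%:E)%E}.
  have := law_mixture_ae s0 FJ; apply: filterS => z zJ.
  have intf : (law_at Z s z).-integrable setT (fun w => (f (Z T w))%:E).
    apply: (@bounded_integrable _ _ _ _ _ Mf) => // w.
    by rewrite ger0_norm.
  have intJ' : (law_at Z s z).-integrable setT J'.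
    have BT0 := le_trans (I_ge0 _) (IB _).
    have J'E w : J' w = (fine (J' w))%:E.
      rewrite fineK// ge0_fin_numE//; apply: (@le_lt_trans _ _ (B * (T - s))%:E).
        by rewrite /J' ge_min lexx orbT.
      by rewrite ltry.
    rewrite (_ : J' = EFin \o (fine \o J')); last exact/funext.
    apply: (@bounded_integrable _ _ _ _ _ (B * (T - s))).
      exact: measurableT_comp.
    move=> w /=; rewrite ger0_norm ?fine_ge0// -lee_fin -J'E.
    by rewrite /J' ge_min lexx orbT.
  rewrite ueq ?s0//.
  rewrite (@ae_eq_integral_any _ _ _ _ _
    (fun w => (f (Z T w))%:E - J' w)%E); last first.
    by apply: filterS zJ => w wJ; rewrite -IJ'.
  by rewrite integralB// subeK//; exact: integrable_fin_num.
have mu_s : measurable_fun [set: borel S] (u s) by case: (bu s); rewrite ?s0.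
have u_ge0 x : 0 <= u s x by case: (bu s); rewrite ?s0.
have intJ' : (\int[law Z s nu]_w J' w = \int[law Z s nu]_w J w)%E.
  apply: ae_eq_integral_any; apply: filterS FJ => w wJ.
  by rewrite -IJ'// wJ.
have Efin : (\int[nu]_z ((u s z)%:E + \int[law_at Z s z]_w J' w) =
    \int[nu]_z \int[law_at Z s z]_w (f (Z T w))%:E)%E.
  exact: ae_eq_integral_any.
rewrite ge0_integralD// in Efin; last 4 first.
- by move=> x _; rewrite lee_fin.
- exact/measurable_EFinP.
- by move=> x _; exact: integral_ge0.
- exact: measurable_law_int.
rewrite -!law_mixture_int// in Efin; last 2 first.
- exact/measurable_EFinP.
- by move=> w; rewrite lee_fin.
move: Efin; rewrite intJ' intJ.
have -> : (\int[nu]_z (u s z)%:E = \int[law_at Z r y]_w (u s (Z s w))%:E)%E.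
  apply: (@traj_law_int _ _ _ _ _ Z r _ s s0 (EFin \o u s)) => [|x].
    exact/measurable_EFinP.
  by rewrite lee_fin.
have -> : (\int[law Z s nu]_w (f (Z T w))%:E =
    \int[law_at Z r y]_w (f (Z T w))%:E)%E.
  apply: (restart_int _ _ _ (h := EFin \o f)) => //.
  exact/measurable_EFinP.
move=> <-; congr (_ + _)%E; apply: eq_integral => q.
by rewrite inE /= in_itv /= => /pE.
Qed.

End log_laplace_theory.

(** * Means of bounded functions *)

Section bounded_expectation.
Context (R : realType) (d : measure_display) (T : measurableType d).

Definition bounded_measurable (g : T -> R) : Prop :=
  measurable_fun [set: T] g /\ exists B, forall x, `|g x| <= B.

Lemma bounded_measurable_cst k : bounded_measurable (fun=> k).
Proof. by split => //; exists `|k|. Qed.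

Lemma bounded_measurableZ k g : bounded_measurable g ->
  bounded_measurable (fun x => k * g x).
Proof.
move=> [mg [B gB]]; split; first exact: measurable_funM.
by exists (`|k| * B) => x; rewrite normrM ler_wpM2l.
Qed.

Lemma bounded_measurableD g h : bounded_measurable g -> bounded_measurable h ->
  bounded_measurable (fun x => g x + h x).
Proof.
move=> [mg [B gB]] [mh [C hC]]; split; first exact: measurable_funD.
by exists (B + C) => x; rewrite (le_trans (ler_normD _ _))// lerD.
Qed.

Lemma bounded_measurableB g h : bounded_measurable g -> bounded_measurable h ->
  bounded_measurable (fun x => g x - h x).
Proof.
move=> [mg [B gB]] [mh [C hC]]; split; first exact: measurable_funB.
by exists (B + C) => x; rewrite (le_trans (ler_normB _ _))// lerD.
Qed.

Context (P : probability T R).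
Implicit Types g h : T -> R.
Local Notation E g := (\int[P]_x (g x))%R.

Lemma bounded_measurable_integrable g : bounded_measurable g ->
  P.-integrable [set: T] (EFin \o g).
Proof. by move=> [mg [B gB]]; exact: bounded_integrable mg gB. Qed.

Lemma bounded_expectation_fin g : bounded_measurable g ->
  (\int[P]_x (g x)%:E = (E g)%:E)%E.
Proof.
move=> /bounded_measurable_integrable ig.
by rewrite /Rintegral fineK//; exact: integrable_fin_num.
Qed.

Lemma bounded_expectation_cst k : E (fun=> k) = k.
Proof.
by rewrite Rintegral_cst// [X in fine X](@probability_setT _ _ _ P) mulr1.
Qed.

Lemma bounded_expectationZ k g : bounded_measurable g ->
  E (fun x => k * g x) = k * E g.
Proof. by move=> /bounded_measurable_integrable ig; rewrite RintegralZl. Qed.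

Lemma bounded_expectationD g h : bounded_measurable g -> bounded_measurable h ->
  E (fun x => g x + h x) = E g + E h.
Proof.
move=> /bounded_measurable_integrable ig /bounded_measurable_integrable ih.
by rewrite RintegralD.
Qed.

Lemma bounded_expectationB g h : bounded_measurable g -> bounded_measurable h ->
  E (fun x => g x - h x) = E g - E h.
Proof.
move=> /bounded_measurable_integrable ig /bounded_measurable_integrable ih.
by rewrite RintegralB.
Qed.

Lemma bounded_expectation_le g h : bounded_measurable g -> bounded_measurable h ->
  (forall x, g x <= h x) -> E g <= E h.
Proof.
move=> /bounded_measurable_integrable ig /bounded_measurable_integrable ih gh.
by apply: le_Rintegral => // x _; exact: gh.
Qed.

End bounded_expectation.

Lemma bounded_etaZ (R : realType) (d : measure_display) (S : measurableType d)
    (eta : {mfun S >-> R}) (k : R) (phi : S -> R) : 0 <= k ->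
  bounded_eta eta phi -> bounded_eta eta (fun x => k * phi x).
Proof.
move=> k0 [mphi phi0 [B phiB] [C phiC]]; split; first exact: measurable_funM.
- by move=> y; rewrite mulr_ge0.
- by exists (k * B) => y; rewrite ler_wpM2l.
- by exists (k * C) => y; rewrite -mulrA ler_wpM2l.
Qed.

Section terminal_mean.
Context (R : realType) (S : ptopologicalType)
  (d : measure_display) (Om : measurableType d)
  (Z : markov_process Om (borel S) [set t : R | 0 <= t])
  (eta : {mfun borel S >-> R})
  (T : R) (phi : borel S -> R) (hphi : bounded_eta eta phi).

Definition mean_at (t : R) (y : borel S) : R :=
  (\int[law_at Z t y]_w (phi (Z T w)))%R.
Local Notation H := mean_at.

Lemma law_initial_expectation (r : R) (y : borel S) (h : borel S -> R) :
    0 <= r -> measurable_fun [set: borel S] h -> (forall x, 0 <= h x) ->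
  (\int[law_at Z r y]_w (h (Z r w)))%R = h y.
Proof.
move=> r0 mh h0; rewrite /Rintegral.
rewrite (law_initial_int Z y r0 (h := EFin \o h))//.
exact/measurable_EFinP.
Qed.

Lemma bounded_phi_traj : 0 <= T -> bounded_measurable (fun w => phi (Z T w)).
Proof.
move=> T0; have [mphi phi0 [B phiB] _] := hphi; split.
  by apply: measurableT_comp mphi _; exact: measurable_traj.
by exists B => w; rewrite ger0_norm.
Qed.

Lemma mean_at_ge0 t y : 0 <= H t y.
Proof. by apply: Rintegral_ge0 => w _; have [_ phi0 _ _] := hphi; exact: phi0. Qed.

Lemma mean_at_le B t y : 0 <= T -> (forall x, phi x <= B) -> H t y <= B.
Proof.
move=> T0 phiB; rewrite -[leRHS](bounded_expectation_cst (law_at Z t y)).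
apply: bounded_expectation_le => //; first exact: bounded_phi_traj.
exact: bounded_measurable_cst.
Qed.

Lemma measurable_mean_at t : 0 <= t -> 0 <= T -> measurable_fun [set: borel S] (H t).
Proof.
move=> t0 T0; apply: measurableT_comp => //; apply: measurable_law_int => //.
  by apply/measurable_EFinP; have [] := bounded_phi_traj T0.
by move=> w; rewrite lee_fin; have [_ phi0 _ _] := hphi; exact: phi0.
Qed.

(** This is the martingale property of [H (s, Z_s)]. *)
Lemma mean_at_tower r s y : 0 <= r -> r <= s -> s <= T ->
  (\int[law_at Z r y]_w (H s (Z s w)))%R = H r y.
Proof.
move=> r0 rs sT; have [mphi phi0 _ _] := hphi.
have T0 : 0 <= T by exact: le_trans (le_trans r0 rs) sT.
have := @law_tower _ _ _ _ _ Z r s T y (EFin \o phi) r0 rs sT.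
rewrite /mean_at /Rintegral => <-; last 2 first.
- exact/measurable_EFinP.
- by move=> x /=; rewrite lee_fin.
congr fine; apply: eq_integral => w _ /=.
by rewrite [RHS]bounded_expectation_fin//; exact: bounded_phi_traj.
Qed.

End terminal_mean.

(** * Scalar inequalities *)

Section scalar_lemmas.
Context (R : realType).

(** On an interval of length at most [1 / (2 K)] the inequality gives
    [sup w <= w s + sup w / 2], hence [sup w <= 2 * w s].  Chaining [N] such
    intervals gives the power of [2].  The hypothesis [step] is the integral
    inequality [w t <= w s + K * int_s^t w] with the integral replaced by its
    upper bounds, so that [w] need not be measurable. *)
Lemma gronwall_halving (w : R -> R) (K B b : R) : 0 <= K ->
  forall (N : nat) (a : R), a <= b -> (forall q, a <= q <= b -> 0 <= w q <= B) ->
    (forall s t W, a <= s -> s <= t -> t <= b ->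
       (forall q, s <= q <= t -> w q <= W) -> w t <= w s + K * (t - s) * W) ->
    2 * K * (b - a) <= N%:R -> w b <= 2 ^+ N * w a.
Proof.
move=> K0; elim=> [|N IH] a ab wB step KN.
  have K00 : K * (b - a) = 0.
    by apply/eqP; rewrite eq_le mulr_ge0 ?subr_ge0// andbT; lra.
  have := step a b B (lexx _) ab (lexx _).
  rewrite K00 mul0r addr0 expr0 mul1r; apply => q /wB /andP[]//.
pose c := a + (b - a) / N.+1%:R.
have N0 : (0 : R) < N.+1%:R by [].
have NE : (N.+1%:R : R) = N%:R + 1 by rewrite natr1.
have cE : (c - a) * N.+1%:R = b - a by rewrite /c addrC addKr divfK// gt_eqF.
have ac : a <= c by rewrite /c lerDl divr_ge0 ?subr_ge0.
have cb : c <= b.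
  rewrite -subr_ge0; have -> : b - c = (c - a) * N%:R.
    by move: cE; rewrite NE mulrDr mulr1 => ?; lra.
  by rewrite mulr_ge0 ?subr_ge0.
have Kc : 2 * K * (c - a) <= 1.
  by rewrite -(ler_pM2r N0) -[leLHS]mulrA cE mul1r.
have Kcb : 2 * K * (b - c) <= N%:R.
  have -> : b - c = (c - a) * N%:R.
    by move: cE; rewrite NE mulrDr mulr1 => ?; lra.
  by rewrite mulrA ler_piMl.
have wc : w c <= 2 * w a.
  pose A := [set w q | q in `[a, c]%classic].
  have supA : has_sup A.
    split; first by exists (w a); exists a => //=; rewrite in_itv/= lexx.
    exists B => _ [q qac <-]; move: qac; rewrite /= in_itv/= => /andP[aq qc].
    by have /andP[] : 0 <= w q <= B by apply: wB; rewrite aq (le_trans qc).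
  have wA q : a <= q <= c -> w q <= sup A.
    by move=> qac; apply: ub_le_sup; [case: supA|exists q => //=; rewrite in_itv].
  have A0 : 0 <= sup A.
    have /andP[wa0 _] : 0 <= w a <= B by apply: wB; rewrite lexx.
    by apply: le_trans wa0 _; apply: wA; rewrite lexx.
  have : sup A <= w a + sup A / 2.
    apply: ge_sup; first by case: supA.
    move=> _ [q qac <-]; move: qac; rewrite /= in_itv/= => /andP[aq qc].
    have /= := step a q (sup A) (lexx _) aq (le_trans qc cb).
    move=> /(_ _)/le_trans; apply.
      by move=> p /andP[ap pq]; apply: wA; rewrite ap (le_trans pq).
    rewrite lerD2l mulrC ler_wpM2l//.
    have : K * (q - a) <= K * (c - a) by rewrite ler_wpM2l// lerD2r.
    lra.
  have := wA c; rewrite lexx ac => /(_ isT); lra.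
apply: le_trans (IH c cb _ _ Kcb) _.
- by move=> q /andP[cq qb]; apply: wB; rewrite qb (le_trans ac cq).
- by move=> s t W cs; apply: step; exact: le_trans cs.
by rewrite exprSr -mulrA ler_wpM2l.
Qed.

(** If [u <= v] the left side is nonpositive.  If [v < u], then
    [v u^beta <= u v^beta] because [beta <= 1], so
    [u^(1+beta) - v^(1+beta) <= 2 u^beta (u - v)], and [u^beta <= (C e)^beta]
    cancels the weight. *)
Lemma rate_lipschitz (beta C e u v M : R) : 0 < beta <= 1 -> 0 < e ->
    0 <= u <= C * e -> 0 <= v -> 0 <= M -> v - u <= M ->
  u `^ (1 + beta) / (beta * e `^ beta) - v `^ (1 + beta) / (beta * e `^ beta)
    <= 2 * C `^ beta / beta * (M - (v - u)).
Proof.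
move=> /andP[b0 b1] e0 /andP[u0 uC] v0 M0 vuM.
have C0 : 0 <= C by rewrite -(pmulr_lge0 _ e0) (le_trans u0).
have eb0 : 0 < e `^ beta by exact: powR_gt0.
have D0 : 0 < beta * e `^ beta by exact: mulr_gt0.
have powS x : 0 <= x -> x `^ (1 + beta) = x * x `^ beta.
  move=> x0; rewrite powRD ?powRr1//; apply/implyP => /eqP; lra.
rewrite -mulrBl ler_pdivrMr//.
have -> : 2 * C `^ beta / beta * (M - (v - u)) * (beta * e `^ beta) =
    2 * (C * e) `^ beta * (M - (v - u)).
  by rewrite powRM//; [field; rewrite gt_eqF|exact: ltW].
have CM : 0 <= 2 * (C * e) `^ beta * (M - (v - u)).
  by rewrite mulr_ge0 ?mulr_ge0 ?powR_ge0// subr_ge0.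
have [uv|vu] := leP u v.
  apply: le_trans CM; rewrite subr_le0 ge0_ler_powR ?nnegrE//; lra.
have b0' := ltW b0; have Ce0 : 0 <= C * e by exact: le_trans uC.
have uCb : u `^ beta <= (C * e) `^ beta by rewrite ge0_ler_powR ?nnegrE.
have ub0 : 0 <= u `^ beta := powR_ge0 _ _.
have vb0 : 0 <= v `^ beta := powR_ge0 _ _.
have vub : v `^ beta <= u `^ beta by rewrite ge0_ler_powR ?nnegrE ?(ltW vu).
apply: (@le_trans _ _ (2 * u `^ beta * (u - v))); last first.
  apply: (@le_trans _ _ (2 * (C * e) `^ beta * (u - v))).
    apply: ler_wpM2r; first by rewrite subr_ge0 ltW.
    by rewrite ler_pM2l.
  by apply: ler_wpM2l; [rewrite mulr_ge0 ?powR_ge0|lra].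
rewrite !powS//.
have vu1 : v * u `^ beta <= u * v `^ beta.
  have [->|vn0] := eqVneq v 0; first by rewrite mul0r mulr_ge0// powR_ge0.
  have v_gt0 : 0 < v by rewrite lt_neqAle eq_sym vn0.
  have u_gt0 : 0 < u by exact: lt_trans vu.
  have split_ x : 0 < x -> x = x `^ beta * x `^ (1 - beta).
    move=> x0; rewrite -powRD ?subrKC ?powRr1 ?ltW//.
    by apply/implyP; rewrite gt_eqF.
  rewrite {1}(split_ v)// [in leRHS](split_ u)//.
  have : v `^ (1 - beta) <= u `^ (1 - beta).
    by rewrite ge0_ler_powR ?nnegrE ?(ltW vu)//; lra.
  rewrite -subr_ge0 => /(mulr_ge0 (mulr_ge0 vb0 ub0)); lra.
nra.
Qed.

(** [c^beta / beta * g^(1 + beta)] is the derivative of [profile] at a time where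
    its value is [g]; this is the inequality that makes [profile * H] a
    subsolution. *)
Lemma subsolution_rate (beta c e g H : R) : 0 < beta -> 0 < e -> 0 <= g ->
    0 <= H <= c * e ->
  (g * H) `^ (1 + beta) / (beta * e `^ beta) <=
    c `^ beta / beta * g `^ (1 + beta) * H.
Proof.
move=> b0 e0 g0 /andP[H0 Hc].
have c0 : 0 <= c by rewrite -(pmulr_lge0 _ e0) (le_trans H0).
have eb0 : 0 < e `^ beta by exact: powR_gt0.
rewrite ler_pdivrMr ?mulr_gt0// powRM//.
have -> : H `^ (1 + beta) = H * H `^ beta.
  rewrite powRD ?powRr1//; apply/implyP => /eqP; lra.
have -> : c `^ beta / beta * g `^ (1 + beta) * H * (beta * e `^ beta) =
    g `^ (1 + beta) * (H * (c * e) `^ beta).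
  by rewrite powRM//; [field; rewrite gt_eqF|exact: ltW].
rewrite ler_wpM2l ?powR_ge0// ler_wpM2l//.
by rewrite ge0_ler_powR ?nnegrE ?(ltW b0) ?(le_trans H0).
Qed.

End scalar_lemmas.

Section profile.
Context (R : realType) (beta c eps T : R).
Hypotheses (beta_gt0 : 0 < beta) (eps_gt0 : 0 < eps).
Local Notation mu := (@lebesgue_measure R).

(** The solution of [g' = c^beta / beta * g^(1 + beta)] with
    [g T = eps^(-1/beta)]; the positive [eps] keeps the terminal value finite. *)
Definition profile (t : R) : R := (eps + c `^ beta * (T - t)) `^ (- beta^-1).

Lemma profile_base_gt0 t : t <= T -> 0 < eps + c `^ beta * (T - t).
Proof. by move=> tT; rewrite ltr_wpDr// mulr_ge0 ?powR_ge0 ?subr_ge0. Qed.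

Lemma profile_gt0 t : t <= T -> 0 < profile t.
Proof. by move=> tT; exact/powR_gt0/profile_base_gt0. Qed.

Lemma is_derive_profile (t : R) : t <= T ->
  is_derive t 1 profile (c `^ beta / beta * profile t `^ (1 + beta)).
Proof.
move=> tT; have base0 := profile_base_gt0 tT.
have dbase : is_derive t 1 (fun q => eps + c `^ beta * (T - q)) (- c `^ beta).
  apply: is_derive_eq.
  by rewrite /GRing.scale/=; lra.
have dpow := is_derive1_powR (- beta^-1) base0.
have := @is_derive1_comp _ ((@powR R)^~ (- beta^-1))
  (fun q => eps + c `^ beta * (T - q)) _ _ _ dpow dbase.
move=> /is_derive_eq; apply.
rewrite /profile -powRrM.
have -> : - beta^-1 * (1 + beta) = - beta^-1 - 1 by field; rewrite gt_eqF.
ring.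
Qed.

Lemma profile_cvg (t : R) : t <= T -> profile x @[x --> t] --> profile t.
Proof.
move=> tT; apply: differentiable_continuous; apply/derivable1_diffP.
by have [] := is_derive_profile tT.
Qed.

Lemma profile_FTC (s t : R) : s <= t -> t <= T ->
  (\int[mu]_(q in `[s, t]) (c `^ beta / beta * profile q `^ (1 + beta))%:E =
   (profile t - profile s)%:E)%E.
Proof.
rewrite le_eqVlt => /orP[/eqP-> _|st tT].
  by rewrite set_itv1 integral_set1 subrr.
rewrite EFinB.
have leT q : q \in `]s, t[ -> q <= T.
  by rewrite in_itv/= => /andP[_ qt]; apply: ltW; exact: lt_le_trans tT.
apply: (continuous_FTC2 st).
- apply: continuous_in_subspaceT => q; rewrite inE /= in_itv/= => /andP[_ qt].
  apply: cvgM; first exact: cvg_cst.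
  have qT := le_trans qt tT.
  apply: (cvg_comp (profile : R -> R) ((@powR R)^~ (1 + beta)) (profile_cvg qT)).
  have : differentiable ((@powR R)^~ (1 + beta)) (profile q).
    apply/derivable1_diffP.
    by have [] := is_derive1_powR (1 + beta) (profile_gt0 qT).
  by move=> /differentiable_continuous.
- split.
  + by move=> q /leT qT; have [] := is_derive_profile qT.
  + apply: cvg_at_right_filter; apply: profile_cvg.
    exact: le_trans (ltW st) tT.
  + by apply: cvg_at_left_filter; exact: profile_cvg.
- move=> q /leT qT; rewrite derive1E.
  by have [_ ->] := is_derive_profile qT.
Qed.

Lemma profile_le s t : s <= t -> t <= T -> profile s <= profile t.
Proof.
move=> st tT; rewrite -subr_ge0 -lee_fin -(profile_FTC st tT).
apply: integral_ge0 => q _; rewrite lee_fin mulr_ge0 ?powR_ge0//.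
by rewrite divr_ge0 ?powR_ge0// ltW.
Qed.

End profile.

(** * Comparison with the subsolution *)

Section comparison.
Context (R : realType) (S : ptopologicalType) (hS : metrizable_luzin R S)
  (d : measure_display) (Om : measurableType d)
  (Z : markov_process Om (borel S) [set t : R | 0 <= t])
  (rcZ : forall w t, 0 <= t -> (Z s w : S) @[s --> t^'+] --> (Z t w : S))
  (beta : R) (beta_itv : 0 < beta <= 1)
  (eta : {mfun borel S >-> R}) (eta_gt0 : forall y : S, 0 < eta y)
  (T : R) (phi : borel S -> R) (hphi : bounded_eta eta phi)
  (c eps : R) (eps_gt0 : 0 < eps).
Local Notation mu := (@lebesgue_measure R).
Local Notation H := (mean_at Z T phi).
Local Notation g := (profile beta c eps T).
Local Notation psi u := (branching_rate beta eta u).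

(** With [M] the supremum of the positive part of [D = g H - u] over [[r0, T] x S],
    the claim [contract] bounds [D] by [M * (1 - 2^-N)], uniformly in the starting
    point.  Hence [M <= M * (1 - 2^-N)] and [M = 0].  The bound [u <= g T * c * eta],
    needed for the Lipschitz constant [K], comes from [u <= E f(Z_T) = g T * H]. *)
Lemma log_laplace_ge_profile (r0 : R) (u : R -> borel S -> R) :
    0 <= r0 <= T ->
    (forall t y, r0 <= t <= T -> H t y <= c * eta y) ->
    log_laplace Z beta eta T (fun x => g T * phi x) u ->
  forall t y, r0 <= t <= T -> g t * H t y <= u t y.
Proof.
move=> /andP[r00 r0T] Hc hu; have /andP[b0 b1] := beta_itv.
have T0 : 0 <= T by exact: le_trans r0T.
have [mphi phi0 [B phiB] _] := hphi; have [bu _ _] := hu.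
have g_gt0 t : t <= T -> 0 < g t by exact: profile_gt0.
have gT0 : 0 <= g T by exact/ltW/g_gt0.
have bphiZ := bounded_phi_traj Z hphi T0.
have H0 := mean_at_ge0 Z T hphi.
have HB t y : H t y <= B by exact: (mean_at_le Z hphi).
have B0 : 0 <= B := le_trans (H0 0 point) (HB 0 point).
have hf : bounded_eta eta (fun x => g T * phi x) by exact: bounded_etaZ.
have sub t : r0 <= t <= T -> 0 <= t <= T.
  by move=> /andP[rt ->]; rewrite (le_trans r00 rt).
have u0 t y : r0 <= t <= T -> 0 <= u t y by move=> /sub/bu[_ + _ _]; apply.
have mu_ t : r0 <= t <= T -> measurable_fun [set: borel S] (u t).
  by move=> /sub/bu[].
have u_le t y : r0 <= t <= T -> u t y <= g T * H t y.
  move=> rtT; rewrite -lee_fin.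
  apply: le_trans (log_laplace_le b0 hf hu y (sub _ rtT)) _.
  have := bounded_expectation_fin (law_at Z t y) (bounded_measurableZ (g T) bphiZ).
  by move=> ->; rewrite bounded_expectationZ.
have u_leB t y : r0 <= t <= T -> u t y <= g T * B.
  by move=> rtT; rewrite (le_trans (u_le t y rtT))// ler_wpM2l.
have u_eta t y : r0 <= t <= T -> 0 <= u t y <= g T * c * eta y.
  move=> rtT; rewrite u0// (le_trans (u_le t y rtT))// -mulrA ler_wpM2l// Hc//.
pose K := 2 * (g T * c) `^ beta / beta.
have K0 : 0 <= K by rewrite divr_ge0 ?mulr_ge0 ?powR_ge0// ltW.
have psi0 t y : 0 <= psi u t y by exact: branching_rate_ge0.
(* The Lipschitz estimate against the zero function also bounds the rate. *)
have psiB t y : r0 <= t <= T -> psi u t y <= K * (g T * B).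
  move=> rtT; have uy := u_eta t y rtT.
  have := @rate_lipschitz _ beta (g T * c) (eta y) (u t y) 0 0 beta_itv
    (eta_gt0 y) uy (lexx _) (lexx _).
  rewrite !sub0r opprK oppr_le0 u0// => /(_ isT).
  rewrite powR0 ?mul0r ?subr0; last by rewrite gt_eqF// addr_gt0.
  by move=> /le_trans; apply; rewrite ler_wpM2l// u_leB.
pose D t y := g t * H t y - u t y.
pose A := [set Num.max (D x.1 x.2) 0 | x in [set x : R * borel S | r0 <= x.1 <= T]].
have DB t y : r0 <= t <= T -> D t y <= g T * B.
  move=> rtT; rewrite /D lerBlDr ler_wpDr ?u0// ler_pM ?mean_at_ge0 ?profile_ge0//.
  - by apply/ltW/g_gt0; case/andP: rtT.
  - by apply: profile_le => //; case/andP: rtT.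
have supA : has_sup A.
  split; first by exists (Num.max (D T point) 0); exists (T, point) => //=; rewrite r0T lexx.
  exists (g T * B) => _ [x /= xT <-]; rewrite ge_max DB//= mulr_ge0//.
pose M := sup A.
have DM t y : r0 <= t <= T -> Num.max (D t y) 0 <= M.
  by move=> rtT; apply: ub_le_sup; [case: supA|exists (t, y)].
have M0 : 0 <= M.
  by apply: le_trans (DM T point _); rewrite ?le_max ?lexx ?orbT ?r0T.
have {}DM t y : r0 <= t <= T -> D t y <= M.
  by move=> /DM -/(_ y); apply: le_trans; rewrite le_max lexx.
have [N KN] : exists N : nat, 2 * K * (T - r0) <= N%:R.
  by exists (Num.truncn (2 * K * (T - r0))).+1; exact/ltW/truncnS_gt.
have contract r y : r0 <= r <= T -> M <= 2 ^+ N * (M - D r y).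
  move=> /andP[r0r rT]; have rr := le_trans r00 r0r.
  pose P := law_at Z r y.
  have inT q : r <= q -> q <= T -> r0 <= q <= T by move=> rq ->; rewrite (le_trans r0r).
  have mZ q : r <= q -> measurable_fun [set: Om] (Z q).
    by move=> rq; apply: measurable_traj; exact: le_trans rq.
  have bu_ q : r <= q -> q <= T -> bounded_measurable (fun w => u q (Z q w)).
    move=> rq qT; split; first by apply: measurableT_comp (mZ _ rq); apply: mu_; exact: inT.
    by exists (g T * B) => w; rewrite ger0_norm ?u0 ?u_leB// inT.
  have bH q : r <= q -> q <= T -> bounded_measurable (fun w => H q (Z q w)).
    move=> rq qT; split.
      apply: measurableT_comp (mZ _ rq); apply: (measurable_mean_at Z hphi) => //.
      exact: le_trans rq.
    by exists B => w; rewrite ger0_norm.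
  have bpsi q : r <= q -> q <= T -> bounded_measurable (fun w => psi u q (Z q w)).
    move=> rq qT; split.
      apply: measurableT_comp (mZ _ rq).
      by apply: measurable_branching_rate; apply: mu_; exact: inT.
    by exists (K * (g T * B)) => w; rewrite ger0_norm ?psi0 ?psiB// inT.
  (* [w q] is the mean of [M - D (q, Z_q)], the function the Gronwall argument
     applies to. *)
  pose U q := \int[P]_w (u q (Z q w)).
  pose p q := \int[P]_w (psi u q (Z q w)).
  pose w q := \int[P]_w' (M - (g q * H q (Z q w') - u q (Z q w'))).
  have bgH q : r <= q -> q <= T -> bounded_measurable (fun w => g q * H q (Z q w)).
    by move=> rq qT; apply: bounded_measurableZ; exact: bH.
  have bD q : r <= q -> q <= T ->
      bounded_measurable (fun w => g q * H q (Z q w) - u q (Z q w)).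
    by move=> rq qT; apply: bounded_measurableB; [exact: bgH|exact: bu_].
  have bw q : r <= q -> q <= T ->
      bounded_measurable (fun w => M - (g q * H q (Z q w) - u q (Z q w))).
    move=> rq qT; apply: bounded_measurableB; last exact: bD.
    exact: bounded_measurable_cst.
  have wE q : r <= q -> q <= T -> w q = M - (g q * H r y - U q).
    move=> rq qT; rewrite /w bounded_expectationB ?bounded_expectation_cst; last 2 first.
    - exact: bounded_measurable_cst.
    - exact: bD.
    rewrite bounded_expectationB; [|exact: bgH|exact: bu_].
    by rewrite (bounded_expectationZ _ _ (bH _ rq qT)) (mean_at_tower Z hphi y rr rq qT).
  have pE q : r <= q -> q <= T ->
      (\int[P]_w (psi u q (Z q w))%:E = (p q)%:E)%E.
    by move=> rq qT; apply: bounded_expectation_fin; exact: bpsi.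
  have p_ge0 q : 0 <= p q by apply: Rintegral_ge0 => w' _; exact: psi0.
  have p_le_cst q : r <= q -> q <= T -> p q <= K * (g T * B).
    move=> rq qT; rewrite -[leRHS](bounded_expectation_cst P).
    apply: bounded_expectation_le; first exact: bpsi.
      exact: bounded_measurable_cst.
    by move=> w'; apply: psiB; exact: inT.
  have avg q : r <= q -> q <= T -> mu.-integrable `[q, T] (EFin \o p) /\
      U q + \int[mu]_(t in `[q, T]) p t = g T * H r y.
    move=> rq qT; have inq t : t \in `[q, T]%classic -> r <= t /\ t <= T.
      rewrite inE /= in_itv/= => /andP[qt ->]; split => //; exact: le_trans qt.
    have psiB' t x : q <= t <= T -> psi u t x <= K * (g T * B).
      by move=> /andP[qt tT]; apply: psiB; apply: inT => //; exact: le_trans qt.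
    have [mp eq] := log_laplace_averaged hS rcZ b0 hf hu y psiB' rr rq qT.
    have mp' : measurable_fun `[q, T] p.
      apply/measurable_EFinP; apply: eq_measurable_fun mp => t /inq[rt tT].
      exact: pE.
    have ip : mu.-integrable `[q, T] (EFin \o p).
      apply: measurable_bounded_integrable => //.
        rewrite [X in (X < _)%E](lebesgue_measure_itv `[q, T])/=.
        by case: ifP => _; rewrite ?ltry// -EFinD ltry.
      exists (K * (g T * B)); split; first exact: num_real.
      move=> b Kb t /= tq; rewrite ger0_norm// (le_trans _ (ltW Kb))//.
      by have [rt tT] := inq t (mem_set tq); exact: p_le_cst.
    split => //; move: eq.
    rewrite (bounded_expectation_fin _ (bounded_measurableZ (g T) bphiZ)).
    rewrite (bounded_expectationZ _ _ bphiZ) (bounded_expectation_fin _ (bu_ _ rq qT)).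
    have -> : (\int[mu]_(t in `[q, T]) \int[law_at Z r y]_w (psi u t (Z t w))%:E =
       (\int[mu]_(t in `[q, T]) p t)%:E)%E.
      rewrite /Rintegral fineK; last exact: integrable_fin_num.
      by apply: eq_integral => t /inq[rt tT]; exact: pE.
    by rewrite -EFinD => -[].
  have w_bound q : r <= q <= T -> 0 <= w q <= M + g T * B.
    move=> /andP[rq qT]; apply/andP; split.
      by apply: Rintegral_ge0 => w' _; rewrite subr_ge0 DM// inT.
    rewrite -[leRHS](bounded_expectation_cst P).
    apply: bounded_expectation_le; first exact: bw.
      exact: bounded_measurable_cst.
    move=> w'; rewrite lerD2l opprB lerBlDr ler_wpDr ?u_leB ?inT//.
    by rewrite mulr_ge0 ?mean_at_ge0 ?(ltW (g_gt0 _ _)).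
  pose g' q := c `^ beta / beta * g q `^ (1 + beta).
  have p_le q : r <= q -> q <= T -> p q <= g' q * H r y + K * w q.
    move=> rq qT; have inq := inT q rq qT.
    have -> : g' q * H r y + K * w q = \int[P]_w (g' q * H q (Z q w) +
        K * (M - (g q * H q (Z q w) - u q (Z q w)))).
      rewrite bounded_expectationD; last 2 first.
      - by apply: bounded_measurableZ; exact: bH.
      - by apply: bounded_measurableZ; exact: bw.
      rewrite bounded_expectationZ; last exact: bH.
      rewrite bounded_expectationZ; last exact: bw.
      by rewrite (mean_at_tower Z hphi y rr rq qT).
    apply: bounded_expectation_le; first exact: bpsi.
      by apply: bounded_measurableD; apply: bounded_measurableZ; [exact: bH|exact: bw].
    move=> w'; set x := Z q w'.
    have gq0 : 0 <= g q by exact/ltW/g_gt0.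
    have Hx : 0 <= H q x <= c * eta x by rewrite H0 Hc.
    have gH0 : 0 <= g q * H q x by rewrite mulr_ge0.
    have := rate_lipschitz beta_itv (eta_gt0 x) (u_eta q x inq) gH0 M0 (DM q x inq).
    have := subsolution_rate b0 (eta_gt0 x) gq0 Hx.
    rewrite /branching_rate -/K -/(g' q); lra.
  have step s t W : r <= s -> s <= t -> t <= T ->
      (forall q, s <= q <= t -> w q <= W) -> w t <= w s + K * (t - s) * W.
    move=> rs st tT wW; have sT := le_trans st tT; have rt := le_trans rs st.
    have W0 : 0 <= W.
      have /andP[ws0 _] : 0 <= w s <= M + g T * B by apply: w_bound; rewrite rs.
      by apply: le_trans ws0 _; apply: wW; rewrite lexx.
    rewrite !wE//.
    have [_ Us] := avg s rs sT; have [_ Ut] := avg t rt tT.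
    have [ip _] := avg s rs sT.
    have ist : mu.-integrable `[s, t] (EFin \o p).
      by apply: integrableS ip => //; apply: subset_itvl; rewrite bnd_simp.
    have split_int : \int[mu]_(q in `[s, T]) p q - \int[mu]_(q in `[s, t]) p q =
        \int[mu]_(q in `[t, T]) p q.
      rewrite (Rintegral_itvB ip) ?bnd_simp//.
      apply: Rintegral_itv_obnd_cbnd; apply: integrableS ip => //.
      by apply: subset_itvr; rewrite bnd_simp.
    have int_le : \int[mu]_(q in `[s, t]) p q <= (g t - g s) * H r y + K * (t - s) * W.
      have mg' : measurable_fun [set: R] g'.
        apply: measurable_funM => //.
        apply: (measurableT_comp (measurable_powR (1 + beta))).
        apply: (measurableT_comp (measurable_powR (- beta^-1))).
        apply: measurable_funD => //; apply: measurable_funM => //.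
        exact: measurable_funB.
      have g'0 q : 0 <= g' q by rewrite mulr_ge0 ?powR_ge0// divr_ge0 ?powR_ge0// ltW.
      rewrite -lee_fin /Rintegral fineK; last exact: integrable_fin_num.
      have -> : (((g t - g s) * H r y + K * (t - s) * W)%:E =
          \int[mu]_(q in `[s, t]) ((g' q * H r y)%:E + (K * W)%:E))%E.
        rewrite ge0_integralD//; last 3 first.
        - by move=> q _; rewrite lee_fin mulr_ge0.
        - by apply/measurable_EFinP/measurable_funTS/measurable_funM.
        - by move=> q _; rewrite lee_fin mulr_ge0.
        rewrite (_ : (\int[mu]_(q in `[s, t]) (g' q * H r y)%:E)%E =
            ((g t - g s) * H r y)%:E); last first.
          under eq_integral do rewrite EFinM.
          rewrite ge0_integralZr//; last 3 first.
          - by apply/measurable_EFinP; exact: measurable_funTS.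
          - by move=> q _; rewrite lee_fin.
          - by rewrite lee_fin.
          by rewrite (profile_FTC c b0 eps_gt0 st tT).
        rewrite integral_cst//= lebesgue_measure_itv/= lte_fin.
        case: ltP => [_|ts].
          by rewrite -EFinB -EFinM -EFinD; congr EFin; ring.
        have -> : t = s by apply/eqP; rewrite eq_le ts.
        by rewrite mule0 adde0 !subrr mulr0 !mul0r addr0.
      apply: ge0_le_integral => //.
      - by move=> q _; rewrite lee_fin.
      - exact: (measurable_int mu ist).
      - apply/emeasurable_funD => //.
        by apply/measurable_EFinP/measurable_funTS/measurable_funM.
      move=> q; rewrite /= in_itv/= => sqt; have /andP[sq qt] := sqt.
      rewrite -EFinD lee_fin (le_trans (p_le q _ _))//.
      - exact: le_trans sq.
      - exact: le_trans tT.
      by rewrite lerD2l ler_wpM2l// wW.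
    have -> : U s = g T * H r y - \int[mu]_(q in `[s, T]) p q by rewrite -Us addrK.
    have -> : U t = g T * H r y - \int[mu]_(q in `[t, T]) p q by rewrite -Ut addrK.
    rewrite -split_int; move: int_le; rewrite -subr_ge0 => int_le.
    rewrite -subr_ge0; apply: le_trans int_le _; rewrite le_eqVlt; apply/orP; left.
    by apply/eqP; ring.
  have := gronwall_halving K0 rT w_bound step.
  move=> /(_ N); rewrite (wE T)// (wE r)//.
  have [_] := avg T rT (lexx _); rewrite set_itv1 Rintegral_set1 addr0 => ->.
  rewrite subrr subr0 /U (law_initial_expectation Z y rr)//; last 2 first.
  - by apply: mu_; exact: inT.
  - by move=> x; apply: u0; exact: inT.
  apply; apply: le_trans KN; apply: ler_wpM2l; first by rewrite mulr_ge0.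
  exact: lerB.
have two_gt0 : 0 < 2 ^+ N :> R by rewrite exprn_gt0.
have : M <= M * (1 - (2 ^+ N)^-1).
  apply: ge_sup; first by case: supA.
  move=> _ [[r y] /= rT <-]; rewrite ge_max mulr_ge0 ?andbT//; last first.
    by rewrite subr_ge0 invf_le1// exprn_ege1// ler1n.
  have := contract r y rT; rewrite -ler_pdivrMl// => contr.
  by rewrite mulrBr mulr1 lerBrDr -lerBrDl (mulrC M).
rewrite mulrBr mulr1 lerBrDr gerDl pmulr_lle0 ?invr_gt0// => M_le0 t y rtT.
by rewrite -subr_le0; apply: le_trans M_le0; exact: DM.
Qed.

End comparison.

(** * Extinction *)

Section extinction.
Context (R : realType) (S : ptopologicalType) (eta : {mfun borel S >-> R})
  (d : measure_display) (Om : measurableType d) (T : R)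
  (X : markov_process Om (measures_eta eta) `[0, T]).

Lemma extinctE (t : R) :
  extinct X t = X t @^-1` [set m | measure_of m [set: borel S] = 0%E].
Proof.
apply/seteqP; split=> w /=; first by apply.
move=> X0 B mB; apply/eqP; rewrite -measure_le0 -X0.
by apply: le_measure => //; rewrite inE.
Qed.

Lemma measurable_extinct (t : R) : 0 <= t <= T -> measurable (extinct X t).
Proof.
move=> tT; have subT : [set` `[t, t]] `<=` [set` `[0, T]].
  by move=> x; rewrite /= !in_itv/= => /le_anti <-.
rewrite extinctE; apply: (@obs_measurable _ _ _ _ _ _ X `[t, t]) => //.
apply: obs_traj => //; first by rewrite in_itv/= lexx.
apply: sub_sigma_algebra; exists setT => //.
by exists [set 0%E]; rewrite ?setTI.
Qed.

(** [exp (- <f, X_t>)] equals [1] on the event that [X_t] is zero. *)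
Lemma extinct_le (P : probability Om R) (t : R) (f : borel S -> R) :
    0 <= t <= T ->
  (P (extinct X t) <= \int[P]_w expeR (- pairing f (X t w)))%E.
Proof.
move=> tT; rewrite -(setIT (extinct X t)) -integral_indic//; last exact: measurable_extinct.
apply: ge0_ae_le_integral_any => [w|w|]; first by rewrite lee_fin.
  exact: expeR_ge0.
apply: aeW => w; rewrite indicE; case: (boolP (w \in _)) => [|_]; last exact: expeR_ge0.
rewrite inE => Xw; rewrite (_ : pairing f (X t w) = 0%E) ?oppe0 ?expeR0//.
rewrite /pairing (eq_measure_integral mzero) ?integral_measure_zero// => B mB _.
exact: Xw.
Qed.

End extinction.

Theorem lemma3p8 (R : realType)
    (S : ptopologicalType) (hS : metrizable_luzin R S)
    (d : measure_display) (Om : measurableType d)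
    (Z : markov_process Om (borel S) [set t : R | 0 <= t])
    (hZ : right_process Z)
    (T : R) (hT : 0 < T)
    (beta : R) (hbeta : 0 < beta <= 1)
    (eta : {mfun borel S >-> R}) (eta_gt0 : forall y : S, 0 < eta y)
    (eta_comparable : exists2 cT : R, 0 < cT &
       forall (r t : R) (y : S), 0 <= r -> r <= t -> t <= T ->
         ((cT^-1 * eta y)%:E <= 'E_(law_at Z r y)[fun w => eta (Z t w)]
            <= (cT * eta y)%:E)%E)
    (eta_limit : forall e : R, 0 < e -> \forall t \near T^'-, forall y : S,
       (`| harm Z eta T t y - (eta y)%:E | < e%:E)%E)
    (dX : measure_display) (OmX : measurableType dX)
    (X : markov_process OmX (measures_eta eta) `[0, T])
    (hX : superprocess Z beta X)
    (r : R) (z : S) (hr : 0 <= r < T) :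
  (harm Z eta T r z / (sup_ratio Z eta r T * ((T - r) `^ beta^-1)%:E)
     <= - lne (law_at X r (delta_eta eta z) (extinct X T)))%E.
Proof.
have [r0 rT] := andP hr; have rT' := ltW rT; have [b0 b1] := andP hbeta.
have T0 := ltW hT.
have rcZ w t : 0 <= t -> (Z s w : S) @[s --> t^'+] --> (Z t w : S).
  by have [/(_ w)[rc _] _] := hZ; exact: rc.
have [cT cT0 hcT] := eta_comparable.
have harmE t y : harm Z eta T t y = (\int[law_at Z t y]_w (eta (Z T w))%:E)%E.
  by rewrite /harm unlock.
have harm_bounds t y : r <= t <= T ->
    ((cT^-1 * eta y)%:E <= harm Z eta T t y <= (cT * eta y)%:E)%E.
  by move=> /andP[rt tT]; apply: hcT => //; exact: le_trans rt.
have harm_fin t y : r <= t <= T -> harm Z eta T t y = (fine (harm Z eta T t y))%:E.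
  move=> rtT; have /andP[lo hi] := harm_bounds t y rtT; rewrite fineK//.
  by rewrite fin_numE -ltNye -ltey (lt_le_trans _ lo) ?ltNyr// (le_lt_trans hi) ?ltry.
have ratioE t y : r <= t <= T -> (harm Z eta T t y / (eta y)%:E)%E =
    (fine (harm Z eta T t y) / eta y)%:E.
  by move=> rtT; rewrite harm_fin// inver gt_eqF.
set L := law_at X r _ _.
have rTT : r <= T <= T by rewrite rT' lexx.
have rrT : r <= r <= T by rewrite rT' lexx.
have sup_ub t y : r <= t <= T ->
    ((fine (harm Z eta T t y) / eta y)%:E <= sup_ratio Z eta r T)%E.
  by move=> rtT; rewrite -ratioE//; apply: ereal_sup_ubound; exists t, y.
have sup_fin : sup_ratio Z eta r T = (fine (sup_ratio Z eta r T))%:E.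
  rewrite fineK// fin_numE; apply/andP; split.
    by rewrite -ltNye (lt_le_trans _ (sup_ub r z rrT)) ?ltNyr.
  rewrite -ltey; apply: (@le_lt_trans _ _ cT%:E); last by rewrite ltry.
  apply: ge_ereal_sup => _ [t [y [rtT ->]]]; rewrite ratioE// lee_fin.
  rewrite ler_pdivrMr// -lee_fin -harm_fin//.
  by have /andP[] := harm_bounds t y rtT.
pose c := fine (sup_ratio Z eta r T).
have Hc t y : r <= t <= T -> fine (harm Z eta T t y) <= c * eta y.
  by move=> rtT; rewrite -ler_pdivrMr// -lee_fin -sup_fin; exact: sup_ub.
have harm_gt0 : 0 < fine (harm Z eta T r z).
  rewrite -lte_fin -harm_fin//; have /andP[+ _] := harm_bounds r z rrT.
  by apply: lt_le_trans; rewrite lte_fin mulr_gt0// invr_gt0.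
have c0 : 0 < c.
  by rewrite -(pmulr_lgt0 _ (eta_gt0 z)) (lt_le_trans harm_gt0)// Hc.
(* [eta] itself is not bounded, hence not in the class of test functions. *)
pose phi n (x : borel S) : R := Num.min (eta x) n%:R.
have phi0 n x : 0 <= phi n x by rewrite le_min ltW/=.
have hphi n : bounded_eta eta (phi n).
  split => //.
  - exact: measurable_minr.
  - by exists n%:R => x; rewrite ge_min lexx orbT.
  - by exists 1 => x; rewrite mul1r ge_min lexx.
have meanE n t y : (\int[law_at Z t y]_w (phi n (Z T w))%:E)%E =
    (mean_at Z T (phi n) t y)%:E.
  by apply: bounded_expectation_fin; exact: (bounded_phi_traj Z (hphi n) T0).
have mean_le n t y : r <= t <= T -> mean_at Z T (phi n) t y <= c * eta y.
  move=> rtT; apply: le_trans (Hc t y rtT); rewrite -lee_fin -harm_fin// harmE -meanE.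
  apply: ge0_ae_le_integral_any => [w|w|]; first by rewrite lee_fin.
    by rewrite lee_fin ltW.
  by apply: aeW => w; rewrite lee_fin ge_min lexx.
have key n eps : 0 < eps ->
    ((profile beta c eps T r * mean_at Z T (phi n) r z)%:E <= - lne L)%E.
  move=> eps0; pose f x := profile beta c eps T T * phi n x.
  have hf : bounded_eta eta f by apply: bounded_etaZ => //; exact: powR_ge0.
  have TT : 0 <= T <= T by rewrite T0 lexx.
  have [u [hu _ Xu]] := hX T f TT hf.
  have rrT0 : 0 <= r <= T by rewrite r0.
  have := log_laplace_ge_profile hS rcZ hbeta eta_gt0 (hphi n) eps0 rrT0
    (mean_le n) hu z rrT.
  rewrite -lee_fin => /le_trans; apply.
  have L_le : (L <= expeR (- (u r z)%:E))%E.
    apply: le_trans (extinct_le _ _ f TT) _; rewrite Xu//.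
    have [bu _ _] := hu; have [mu _ _ _] := bu r rrT0.
    rewrite /pairing /= integral_dirac//; last exact/measurable_EFinP.
    by rewrite diracT mul1e.
  have L_itv : L \in `[0%E, +oo%E] by rewrite in_itv/= measure_ge0 leey.
  have e_itv : expeR (- (u r z)%:E) \in `[0%E, +oo%E].
    by rewrite in_itv; apply/andP; split; [exact: expeR_ge0|exact: leey].
  by move: L_le; rewrite leeNr -(lee_lne L_itv e_itv) expeRK.
pose A := c `^ beta * (T - r).
have A0 : 0 < A by rewrite mulr_gt0 ?powR_gt0// subr_gt0.
case lneL : (- lne L)%E => [l||]; last 2 first.
- by rewrite leey.
- by have := key 0%N 1 ltr01; rewrite lneL leNgt ltNyr.
(* Let [eps] tend to [0] in [key]. *)
have mean_lel n : mean_at Z T (phi n) r z <= l * A `^ beta^-1.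
  have pow_cvg : (eps + A) `^ beta^-1 @[eps --> 0^'+] --> A `^ beta^-1.
    apply: (@cvg_comp _ _ _ (fun eps => eps + A) ((@powR R)^~ beta^-1) _ (nbhs A)).
      apply: cvg_at_right_filter.
      have : eps + A @[eps --> (0 : R)] --> 0 + A.
        by apply: cvgD; [exact: cvg_id|exact: cvg_cst].
      by rewrite add0r.
    have : differentiable ((@powR R)^~ beta^-1) A.
      by apply/derivable1_diffP; have [] := is_derive1_powR beta^-1 A0.
    by move=> /differentiable_continuous.
  apply: (cvgr_to_ge (cvgM (cvg_cst l) pow_cvg)).
  near=> eps; have eps0 : 0 < eps by near: eps; exact: nbhs_right_gt.
  have := key n eps eps0; rewrite lneL lee_fin /profile powRN -/A mulrC.
  by rewrite ler_pdivrMr ?powR_gt0// addr_gt0.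
(* Let [n] tend to infinity by monotone convergence. *)
have harm_le : fine (harm Z eta T r z) <= l * A `^ beta^-1.
  rewrite -lee_fin -harm_fin// harmE.
  have limE : (\int[law_at Z r z]_w (eta (Z T w))%:E =
      \int[law_at Z r z]_w limn (fun n => (phi n (Z T w))%:E))%E.
    apply: eq_integral => w _; apply/esym/cvg_lim => //.
    apply: cvg_near_cst; exists (Num.truncn (eta (Z T w))).+1 => // n /= tn.
    rewrite /phi min_l//.
    by apply/ltW/(lt_le_trans (truncnS_gt _)); rewrite ler_nat.
  rewrite limE; apply: (cvge_to_le (cvg_monotone_convergence _ _ _ _)) => //.
  - move=> n; apply/measurable_EFinP.
    by have [] := bounded_phi_traj Z (hphi n) T0.
  - by move=> n w _; rewrite lee_fin.
  - move=> w _ n m nm; rewrite lee_fin /phi le_min ge_min lexx/=.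
    by rewrite ge_min ler_nat nm orbT.
  by apply: nearW => n; rewrite meanE lee_fin.
rewrite harm_fin// sup_fin -/c -EFinM inver gt_eqF ?mulr_gt0 ?powR_gt0 ?subr_gt0//.
rewrite -EFinM lee_fin ler_pdivrMr ?mulr_gt0 ?powR_gt0 ?subr_gt0//.
apply: le_trans harm_le _; rewrite /A powRM ?powR_ge0 ?subr_ge0//.
by rewrite -powRrM mulfV ?gt_eqF// powRr1// ltW.
Unshelve. all: by end_near.
Qed.
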